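(* Let $X\subseteq[\omega]^\omega$ be a set with $|X|\geq\mathfrak b$. Then the following assertions are equivalent. (1) The set $X$ is meager-unbounded. (2) For each $G_\delta$-set $G\subseteq P(\omega)$ containing $\mathrm{Fin}$, there is a $\sigma$-compact set $F\subseteq P(\omega)$ such that $F\subseteq G$ and $|X\setminus F|<\mathfrak b$. (3) The set $X\cup\mathrm{Fin}$ is $\mathfrak b$-concentrated on $\mathrm{Fin}$ and for each set $A\subseteq X$ of size smaller than $\mathfrak b$, the set $(X\setminus A)\cup\mathrm{Fin}$ is Hurewicz.
   Context: $P(\omega)$ is the power set of $\omega$ with the topology obtained by identifying subsets of $\omega$ with their characteristic functions in the Cantor cube $2^\omega$. $[\omega]^\omega$ is the set of infinite subsets of $\omega$ and $\mathrm{Fin}$ the set of finite subsets of $\omega$. Each element of $[\omega]^\omega$ is identified with its increasing enumeration, so $[\omega]^\omega$ is viewed as a subset of $\omega^\omega$ (the two subspace topologies coincide). For $a,b\in\omega^\omega$, $a\le^* b$ means $a(n)\le b(n)$ for all but finitely many $n$; $\mathfrak b$ is the minimal cardinality of a subset of $\omega^\omega$ that has no $\le^*$-upper bound in $\omega^\omega$. A space $X$ is Hurewicz if for each sequence $\mathcal U_0,\mathcal U_1,\dots$ of open covers of $X$ there are finite sets $\mathcal F_n\subseteq\mathcal U_n$ such that for each $x\in X$ the set $\{n: x\in\bigcup\mathcal F_n\}$ is cofinite. For an infinite cardinal $\kappa$, a set $Y$ is $\kappa$-concentrated on a set $D\subseteq Y$ if $|Y|\ge\kappa$ and $|Y\setminus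 U|<\kappa$ for each open set $U$ containing $D$. A nonempty set $S\subseteq[\omega]^\omega$ is a semifilter if for all $a\in S$ and $b\in[\omega]^\omega$ with $a\setminus b$ finite we have $b\in S$. It is meager if it is a meager subset of $[\omega]^\omega$. For $a,b\in[\omega]^\omega$, $a\le_S b$ means $\{n: a(n)\le b(n)\}\in S$. A set $X\subseteq[\omega]^\omega$ is meager-unbounded if $|X|\ge\mathfrak b$ and for each $b\in[\omega]^\omega$ there are a meager semifilter $S(b)$ and a set $A\subseteq X$ of size smaller than $\mathfrak b$ such that $b\le_{S(b)}x$ for all $x\in X\setminus A$. *)

(* Defs.v *)
From mathcomp Require Import all_boot.
From mathcomp Require Import all_classical.
From mathcomp Require Import topology borel_hierarchy cantor.

Set Implicit Arguments.
Unset Strict Implicit.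
Unset Printing Implicit Defensive.

Local Open Scope classical_set_scope.
Local Open Scope card_scope.

Definition card_lt T U (A : set T) (B : set U) : Prop :=
  A #<= B /\ ~ (B #<= A).

(* Any nonempty family of sets has a member of least cardinality. Proof due to
   Hönig: a maximal set of choice functions of the family that is projected
   injectively on every coordinate is projected onto some coordinate. *)
Lemma card_le_least (T : Type) (F : set (set T)) :
  F !=set0 -> exists A, F A /\ forall B, F B -> A #<= B.
Proof.
move=> [A0 FA0].
pose P (S : set (set T -> T)) :=
  (forall f A, S f -> F A -> A (f A)) /\
  (forall f g A, S f -> S g -> F A -> f A = g A -> f = g).
have [|S [[Sin Sinj] Smax]] := @Zorn_bigcup _ P.
  move=> C CP Ctot; split.
    by move=> f A [D CD Df]; apply: (CP D CD).1.
  move=> f g A [D CD Df] [E CE Eg].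
  have [DE|ED] := Ctot D E CD CE.
    by apply: (CP E CE).2 => //; exact: DE.
  by apply: (CP D CD).2 => //; exact: ED.
have [A FA AS] : exists2 A, F A & A `<=` (fun f => f A) @` S.
  apply: contrapT => noA.
  have ex A : exists x, F A -> A x /\ ~ ((fun f => f A) @` S) x.
    have [FA|nFA] := pselect (F A); last first.
      have /existsNP[x _] : ~ (A0 `<=` (fun f => f A0) @` S).
        by move=> h; apply: noA; exists A0.
      by exists x.
    have /existsNP[x /not_implyP[Ax nx]] : ~ (A `<=` (fun f => f A) @` S).
      by move=> h; apply: noA; exists A.
    by exists x.
  have [h hP] := choice ex.
  have nSh : ~ S h by move=> Sh; apply: (hP A0 FA0).2; exists h.
  apply: (Smax (h |` S)).
    by split=> [f Sf|hS]; [right|apply: nSh; apply: hS; left].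
  split.
    by move=> f A [->|Sf] FA; [exact: (hP A FA).1|exact: (Sin f A)].
  move=> f g A [->|Sf] [->|Sg] FA //; last exact: Sinj.
    by move=> e; case: (hP A FA).2; exists g.
  by move=> e; case: (hP A FA).2; exists f.
exists A; split=> // B FB.
apply: card_le_trans (subset_card_le AS) _.
apply: card_le_trans (card_image_le _ _) _.
have iS : {in S &, injective (fun f : set T -> T => f B)}.
  by move=> f g /set_mem Sf /set_mem Sg; exact: Sinj.
rewrite -(card_le_eql (inj_card_eq iS)).
by apply: subset_card_le => _ [f Sf <-]; exact: (Sin f B).
Qed.

Definition le_star (a b : nat -> nat) : Prop :=
  finite_set [set n | ~~ (a n <= b n)%N].

Definition star_unbounded (A : set (nat -> nat)) : Prop :=
  ~ exists b, forall a, A a -> le_star a b.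

Lemma star_unboundedT : star_unbounded setT.
Proof.
move=> [b /(_ (fun n => (b n).+1) I)]; rewrite /le_star.
rewrite (_ : [set n | ~~ ((b n).+1 <= b n)%N] = setT); first exact: infinite_nat.
by apply/seteqP; split=> // n _ /=; rewrite ltnn.
Qed.

Lemma bfrak_ex : exists B, star_unbounded B /\
  forall C, star_unbounded C -> B #<= C.
Proof.
have [|B BP] := @card_le_least _ star_unbounded; last by exists B.
by exists setT; exact: star_unboundedT.
Qed.

(* The cardinal b is represented by an unbounded set of least cardinality;
   only its cardinality is ever used. *)
Definition bfrak : set (nat -> nat) := sval (cid bfrak_ex).

Lemma bfrakP : star_unbounded bfrak /\
  forall C, star_unbounded C -> bfrak #<= C.
Proof. exact: (svalP (cid bfrak_ex)). Qed.

Lemma bfrak_infinite : infinite_set bfrak.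
Proof.
move=> /finite_seqP[s bs]; apply: bfrakP.1; rewrite bs.
exists (fun n => \max_(f <- s) f n) => a /= sa; rewrite /le_star.
rewrite (_ : [set n | _] = set0); first exact: finite_set0.
apply/seteqP; split=> // n /= /negP[].
exact: (@leq_bigmax_seq _ s xpredT (fun f => f n) a sa).
Qed.

(* A point of cantor_space is the characteristic function of a subset of
   omega. *)
Definition elts (a : cantor_space) : set nat := [set n | a n].

Definition infsets : set cantor_space := [set a | infinite_set (elts a)].

Definition Fin : set cantor_space := [set a | finite_set (elts a)].

Definition is_incr_enum (A : set nat) (e : nat -> nat) : Prop :=
  {homo e : m n / (m < n)%N} /\ range e = A.

Lemma incr_enum_ex (A : set nat) :
  infinite_set A -> exists e, is_incr_enum A e.
Proof.
move=> Ainf.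
have next n : exists m, [/\ A m, (n <= m)%N &
    forall k, A k -> (n <= k)%N -> (m <= k)%N].
  have ex : exists m, `[< A m >] && (n <= m)%N.
    apply: contrapT => noex; apply: Ainf.
    apply: (@sub_finite_set _ _ `I_n); last exact: finite_II.
    move=> k Ak /=; rewrite ltnNge; apply/negP => nk; apply: noex.
    by exists k; rewrite nk andbT; apply/asboolP.
  have [m /andP[/asboolP Am nm] mmin] := ex_minnP ex.
  exists m; split=> // k Ak nk; apply: mmin.
  by rewrite nk andbT; apply/asboolP.
have [f fP] := choice next.
pose e := fix e n := if n is n'.+1 then f (e n').+1 else f 0%N.
have Ae n : A (e n) by case: n => [|n]; [case: (fP 0%N)|case: (fP (e n).+1)].
have eS n : (e n < e n.+1)%N by have [] := fP (e n).+1.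
have einc : {homo e : m n / (m < n)%N} by exact: (homo_ltn ltn_trans eS).
exists e; split=> //; apply/seteqP; split; first by move=> _ [n _ <-].
move=> k Ak.
have ge_id n : (n <= e n)%N by elim: n => // n IH; exact: leq_ltn_trans (eS n).
have [m km mmin] := ex_minnP (ex_intro (fun n => k <= e n)%N k (ge_id k)).
exists m => //; apply/eqP; rewrite eqn_leq km andbT.
case: m km mmin => [|m] km mmin /=; first by have [_ _] := fP 0%N; apply.
have [_ _] := fP (e m).+1; apply=> //.
by rewrite ltnNge; apply/negP => /mmin; rewrite ltnn.
Qed.

(* The increasing enumeration of a; a junk value when a is finite. *)
Definition enumeration (a : cantor_space) : nat -> nat :=
  xget (id : nat -> nat) (is_incr_enum (elts a)).

Lemma enumerationP (a : cantor_space) :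
  infsets a -> is_incr_enum (elts a) (enumeration a).
Proof. by move=> /incr_enum_ex[e eP]; exact: (xgetPex (id : nat -> nat) (ex_intro _ e eP)). Qed.

Definition hurewicz (T : topologicalType) : Prop :=
  forall U : nat -> set (set T),
    (forall n, U n `<=` open /\ \bigcup_(V in U n) V = setT) ->
    exists F : nat -> set (set T),
      (forall n, finite_set (F n) /\ F n `<=` U n) /\
      (forall x, finite_set (~` [set n | (\bigcup_(V in F n) V) x])).

Definition sigma_compact (T : topologicalType) (A : set T) : Prop :=
  exists K : nat -> set T, (forall n, compact (K n)) /\ A = \bigcup_n K n.

Definition nowhere_dense (T : topologicalType) (A : set T) : Prop :=
  interior (closure A) = set0.

Definition meager (T : topologicalType) (A : set T) : Prop :=
  exists N : nat -> set T,
    (forall n, nowhere_dense (N n)) /\ A `<=` \bigcup_n N n.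

(* The infinite cardinal kappa is given as the cardinality of the set K. *)
Definition concentrated (C : Type) (K : set C) (T : topologicalType)
    (Y D : set T) : Prop :=
  [/\ D `<=` Y, K #<= Y &
      forall U : set T, open U -> D `<=` U -> card_lt (Y `\` U) K].

Definition semifilter (S : set cantor_space) : Prop :=
  [/\ S !=set0, S `<=` infsets &
      forall a b, S a -> infsets b -> finite_set (elts a `\` elts b) -> S b].

(* Meagerness is taken in the subspace infsets, not in cantor_space. *)
Definition meager_semifilter (S : set cantor_space) : Prop :=
  semifilter S /\ meager [set x : set_type infsets | S (set_val x)].

Definition le_mod (S : set cantor_space) (a b : cantor_space) : Prop :=
  S (fun n => (enumeration a n <= enumeration b n)%N).

Definition meager_unbounded (X : set cantor_space) : Prop :=
  [/\ X `<=` infsets, bfrak #<= X &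
      forall b, infsets b -> exists S A,
        [/\ meager_semifilter S, A `<=` X, card_lt A bfrak &
            forall x, (X `\` A) x -> le_mod S b x]].

(* Main.v *)
(**
(1) => (2). If every open set of a decreasing sequence contains Fin, there are
consecutive blocks [b(k), b(k+1)) such that every x missing infinitely many of
them lies in the intersection G. If x(n) >= b(2n+1), then by the pigeonhole
principle x misses a block with index in [n, 2n]. Meager unboundedness applied
to n |-> b(2n+1) says that for all x in X but fewer than b many this happens for
some n in almost every interval [h(k), h(k+1)), where h comes from Talagrand's
characterization of meager semifilters; the set of x that miss some block with
index in [h(k), 2h(k+1)) for almost all k is sigma-compact and contained in G.

(2) => (3). Extend the members of the covers to open sets of P(omega) and apply
(2) to the resulting G_delta set. With respect to a countable base, the index of
a basic set witnessing that x is covered by the n-th cover can be bounded by one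
function of n modulo finitely many n, simultaneously on a sigma-compact set and
on a set with fewer than b points.

(3) => (1). The sets U_n of all x with at most m elements below b(m) for some
m >= n are open and contain Fin, so by concentration and the uncountable
cofinality of b, fewer than b points of X lie outside their intersection. The
Hurewicz property of the rest bounds the witness m by g(n) for almost all n, and
the sets meeting almost all intervals [n, g(n)) form a meager semifilter.
*)
Require Import Defs.
From mathcomp Require Import all_boot.
From mathcomp Require Import all_classical.
From mathcomp Require Import topology borel_hierarchy cantor.
From mathcomp Require Import zify.

Local Open Scope classical_set_scope.
Local Open Scope card_scope.

(** * Cylinders in the Cantor space and its subspaces *)

Definition agree (m : nat) (x y : nat -> bool) : Prop :=
  forall i, (i < m)%N -> x i = y i.

Lemma agreeW {m n x y} : (m <= n)%N -> agree n x y -> agree m x y.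
Proof. by move=> mn xy i im; apply: xy; exact: leq_trans mn. Qed.

Lemma agree_trans {m x y z} : agree m x y -> agree m y z -> agree m x z.
Proof. by move=> xy yz i im; rewrite xy// yz. Qed.

Lemma agree_nbhs (x : cantor_space) m : nbhs x (agree m x : set cantor_space).
Proof.
elim: m => [|m IH]; first by apply: filterS filterT => y _ i.
have : nbhs x (proj m @^-1` [set x m] : set cantor_space).
  by apply: (@proj_continuous nat (fun=> bool) m x); exact: discrete_set1.
move: IH; apply: filterS2 => y xy /= ym i; rewrite ltnS leq_eqVlt.
by case/orP=> [/eqP ->|/xy//]; rewrite -ym.
Qed.

Lemma nbhs_agree {x : cantor_space} {B} :
  nbhs x B -> exists m, (agree m x : set cantor_space) `<=` B.
Proof.
pose F := filter_from [set: nat] (fun m => agree m x : set cantor_space).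
have FF : Filter F.
  apply: filter_from_filter; first by exists 0%N.
  move=> i j _ _; exists (maxn i j) => // y xy.
  by split; apply: agreeW xy; rewrite ?leq_maxl ?leq_maxr.
have Fx : F --> x.
  apply/cvg_sup => i U [V [[W oW <-] Wxi WU]].
  exists i.+1 => // y xy; apply: WU; rewrite /= /proj -(xy i)//.
by move=> /Fx [m _ mB]; exists m.
Qed.

Lemma open_agreeP (U : set cantor_space) :
  open U <-> forall x, U x -> exists m, forall y, agree m x y -> U y.
Proof.
rewrite openE; split=> [oU x /oU /nbhs_agree[m mU]|oU x Ux].
  by exists m.
by have [m mU] := oU x Ux; apply: filterS (agree_nbhs x m) => y; exact: mU.
Qed.

Lemma sub_agree_nbhs {A : set cantor_space} (x : A) m :
  nbhs x [set y : A | agree m (\val x) (\val y)].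
Proof.
exact: (@initial_continuous _ _ (set_val : A -> cantor_space) x _ (agree_nbhs _ _)).
Qed.

Lemma sub_nbhs_agree {A : set cantor_space} {x : A} {B : set A} :
  nbhs x B -> exists m, forall y : A, agree m (\val x) (\val y) -> B y.
Proof.
move=> [_ [[W /open_agreeP oW <-] /oW[m mW] WB]].
by exists m => y xy; apply: WB; apply: mW.
Qed.

Lemma finite_prefixes n : exists L : seq cantor_space,
  forall x : cantor_space, exists2 p, p \in L & agree n p x.
Proof.
exists [seq (nth false (val t) : cantor_space) | t : n.-tuple bool] => x.
pose t := mktuple (fun i : 'I_n => x i).
exists (nth false (val t)); first by apply/mapP; exists t; rewrite ?mem_enum.
by move=> i ilt; rewrite -[i]/(val (Ordinal ilt)) -tnth_nth tnth_mktuple.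
Qed.

(** * Finiteness, eventual domination and sets of fewer than [bfrak] points *)

Lemma finite_bounded {A : set nat} :
  finite_set A -> exists m, forall i, A i -> (i < m)%N.
Proof.
move=> /finite_seqP[s ->]; exists (\max_(i <- s) i).+1 => i /= si.
exact: (@leq_bigmax_seq _ s xpredT id i si).
Qed.

Lemma finite_boundedP (A : set nat) :
  finite_set A <-> exists m, forall i, A i -> (i < m)%N.
Proof.
split; first exact: finite_bounded.
by move=> [m mA]; apply: sub_finite_set (finite_II m) => i /mA.
Qed.

Lemma cofinite_eventually (A : set nat) :
  finite_set (~` A) <-> exists m, forall i, (m <= i)%N -> A i.
Proof.
rewrite finite_boundedP; split=> -[m mA]; exists m => i.
  by apply: contraPP => nAi; rewrite leqNgt; apply/negP/negPn/mA.
by move=> nAi; rewrite ltnNge; apply/negP => /mA.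
Qed.

Lemma infsets_frequently (x : cantor_space) :
  infsets x <-> forall m, exists2 i, (m <= i)%N & x i.
Proof.
rewrite /infsets /elts /= finite_boundedP; split=> [ninf m|xinf [m mx]].
  apply: contrapT => nx; apply: ninf; exists m => i xi.
  by rewrite ltnNge; apply/negP => mi; apply: nx; exists i.
by have [i mi /mx] := xinf m; rewrite ltnNge mi.
Qed.

Lemma le_starP (a b : nat -> nat) :
  le_star a b <-> exists m, forall n, (m <= n)%N -> (a n <= b n)%N.
Proof.
rewrite -(cofinite_eventually [set n | (a n <= b n)%N]) /le_star.
by split; apply: sub_finite_set => n /= /negP.
Qed.

Lemma le_star_trans (a b c : nat -> nat) :
  le_star a b -> le_star b c -> le_star a c.
Proof.
move=> /le_starP[m ab] /le_starP[n bc]; apply/le_starP; exists (maxn m n) => k.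
by rewrite geq_max => /andP[mk nk]; exact: leq_trans (ab k mk) (bc k nk).
Qed.

Lemma le_star_seq_bound (g : nat -> nat -> nat) :
  exists h, forall n, le_star (g n) h.
Proof.
(* Diagonal bound: at [k] only the functions [g 0], ..., [g k] are dominated. *)
exists (fun k => \max_(n < k.+1) g n k) => n; apply/le_starP; exists n => k nk.
by rewrite (leq_bigmax (Ordinal (nk : n < k.+1)%N)).
Qed.

(** Disjoint copies of [A] and [B] in [T + U] form a family with a member of least cardinality. *)
Lemma card_le_total {T U} {A : set T} {B : set U} : ~ (B #<= A) -> A #<= B.
Proof.
have iA : (inl @` A : set (T + U)) #= A by apply: inj_card_eq => x y _ _ [].
have iB : (inr @` B : set (T + U)) #= B by apply: inj_card_eq => x y _ _ [].
rewrite -(card_le_eql iA) -(card_le_eqr iA) -(card_le_eql iB) -(card_le_eqr iB).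
move=> nBA; have [|C [CAB Cmin]] :=
    @card_le_least _ [set C | C = inl @` A \/ C = inr @` B].
  by exists (inl @` A); left.
by case: CAB Cmin => -> Cmin; [apply: Cmin; right|case: nBA; apply: Cmin; left].
Qed.

Lemma card_lt_subset {T U} {A B : set T} {K : set U} :
  A `<=` B -> card_lt B K -> card_lt A K.
Proof.
move=> /subset_card_le AB [BK nKB]; split; first exact: card_le_trans AB BK.
by move=> KA; apply: nKB; exact: card_le_trans KA AB.
Qed.

(** The image of [A] under [f] is too small to be unbounded, by minimality of [bfrak]. *)
Lemma card_lt_bfrak_bounded {T} {A : set T} (f : T -> nat -> nat) :
  card_lt A bfrak -> exists g, forall x, A x -> le_star (f x) g.
Proof.
move=> [_ nbA]; have [g fg] : exists g, forall a, (f @` A) a -> le_star a g.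
  apply: contrapT => unb; apply: nbA.
  by apply: card_le_trans (bfrakP.2 _ unb) _; exact: card_image_le.
by exists g => x Ax; apply: fg; exists x.
Qed.

(* The cofinality of b is uncountable. *)
Lemma card_lt_bfrak_bigcup {T} (A : nat -> set T) :
  (forall n, card_lt (A n) bfrak) -> card_lt (\bigcup_n A n) bfrak.
Proof.
move=> Alt; suff nbA : ~ (bfrak #<= \bigcup_n A n).
  by split=> //; exact: card_le_total.
move=> /pcard_geP/unsquash f; apply: bfrakP.1.
(* A surjection [f] onto [bfrak] has values bounded by [g n] on [A n]; a common bound [h] of all
   [g n] would bound [bfrak]. *)
have [g fg] := choice (fun n => card_lt_bfrak_bounded f (Alt n)).
have [h gh] := le_star_seq_bound g.
exists h => a /('surj_f)[x [n _ Anx] <-].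
by apply: le_star_trans (gh n); exact: fg.
Qed.

(** * From concentration and the Hurewicz property to meager unboundedness *)

Definition hits (g : nat -> nat) : set cantor_space :=
  [set a | exists N, forall n, (N <= n)%N -> exists2 m, (n <= m < g n)%N & a m].

Lemma hits_infsets g : hits g `<=` infsets.
Proof.
move=> a [N aN]; apply/infsets_frequently => n.
have [m /andP[nm _] am] := aN _ (leq_maxl N n).
by exists m => //; apply: leq_trans nm; exact: leq_maxr.
Qed.

(** Cylinders form a base, so each must contain one disjoint from [N]; lengthening the latter
    secures [m <= m']. *)
Lemma nowhere_denseP {A : set cantor_space} (N : set A) :
  nowhere_dense N <-> forall (x : A) m, exists (y : A) m',
    [/\ agree m (\val x) (\val y), (m <= m')%N &
        forall z : A, agree m' (\val y) (\val z) -> ~ N z].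
Proof.
split=> [Nnd x m|Nnd].
  apply: contrapT => noy.
  suff : (closure N)° x by rewrite Nnd.
  apply: filterS (sub_agree_nbhs x m) => y xy B /sub_nbhs_agree[k kB].
  apply: contrapT => NB; apply: noy; exists y, (maxn m k).
  split=> //; first exact: leq_maxl.
  move=> z yz Nz; apply: NB; exists z; split=> //; apply: kB.
  by apply: agreeW yz; exact: leq_maxr.
apply/seteqP; split=> // x /sub_nbhs_agree[m mN].
have [y [m' [xy _ yN]]] := Nnd x m.
have [z [Nz /yN]] := mN y xy _ (sub_agree_nbhs y m'); exact.
Qed.

Lemma hits_meager_semifilter g :
  (forall n, (n < g n)%N) -> meager_semifilter (hits g).
Proof.
move=> ltg; split.
  split; last 1 first.
  - move=> a b [N aN] _ /finite_bounded[k abk]; exists (maxn N k) => n.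
    rewrite geq_max => /andP[Nn kn]; have [m /andP[nm mg] am] := aN n Nn.
    exists m; first by rewrite nm.
    apply: contrapT => nbm; have := abk m (conj am nbm).
    by rewrite ltnNge (leq_trans kn nm).
  - exists (fun=> true); exists 0%N => n _; exists n => //.
    by rewrite leqnn ltg.
  - exact: hits_infsets.
exists (fun N => [set x : set_type infsets |
  forall n, (N <= n)%N -> exists2 m, (n <= m < g n)%N & set_val x m]).
split; last by move=> x [N xN]; exists N.
move=> N; apply/nowhere_denseP => x m.
(* [y] follows [x] below [m], is empty on the interval from [n] to [g n], which violates the [N]-th
   condition, and is full afterwards to be infinite. *)
pose n := maxn m N; pose y : cantor_space :=
  fun i => if (i < m)%N then set_val x i else (g n <= i)%N.
have yinf : infsets y.
  apply/infsets_frequently => k; exists (maxn k (maxn m (g n))).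
    exact: leq_maxl.
  by rewrite /y ifN ?leq_max ?leqnn ?orbT// -leqNgt !leq_max leqnn orbT.
exists (SigSub (mem_set yinf)), (maxn m (g n)).
split; first by move=> i im /=; rewrite /y im.
  exact: leq_maxl.
move=> z /= yz zN; have [i /andP[ni ig] zi] := zN n (leq_maxr _ _).
have mi : (m <= i)%N by apply: leq_trans ni; exact: leq_maxl.
have : y i by rewrite (yz i)// leq_max ig orbT.
by rewrite /y ltnNge mi/= leqNgt ig.
Qed.

(** The bound [k] on the witness makes this an increasing open family, so that finitely many members
    of the cover amount to one bound. *)
Definition sparse (b : nat -> nat) (n k : nat) : set cantor_space :=
  [set x | exists2 m, (n <= m < k)%N & (count x (iota 0 (b m)) <= m)%N].

Lemma sparseW b n k l : (k <= l)%N -> sparse b n k `<=` sparse b n l.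
Proof.
move=> kl x [m /andP[nm mk] xm]; exists m => //.
by rewrite nm (leq_trans mk kl).
Qed.

Lemma open_sparse b n k : open (sparse b n k).
Proof.
apply/open_agreeP => x [m nmk xm]; exists (b m) => y xy; exists m => //.
rewrite (_ : count y _ = count x (iota 0 (b m)))//.
by apply: eq_in_count => i; rewrite mem_iota => /xy ->.
Qed.

Lemma Fin_sparse b n : Fin `<=` \bigcup_k sparse b n k.
Proof.
move=> x /finite_bounded[M xM].
exists (maxn n M).+1 => //; exists (maxn n M).
  by rewrite leq_maxl leqnn.
apply: leq_trans (leq_maxr n M).
rewrite -size_filter -{2}(size_iota 0 M).
apply: uniq_leq_size; first by rewrite filter_uniq// iota_uniq.
by move=> i; rewrite mem_filter !mem_iota => /andP[/xM].
Qed.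

(** Otherwise the [m.+1] values [e 0], ..., [e m] would all be elements of [x] below [c]. *)
Lemma count_le_enumeration (x : cantor_space) m c : infsets x ->
  (count x (iota 0 c) <= m)%N -> (c <= enumeration x m)%N.
Proof.
move=> /enumerationP; set e := enumeration x => -[einc eran].
apply: contraTT; rewrite -!ltnNge => emc.
have ele : {homo e : i j / (i <= j)%N} := ltnW_homo einc.
have einj : injective e.
  move=> i j; case: (ltngtP i j) => // /einc + eij;
  by rewrite eij ltnn.
rewrite -size_filter -(size_iota 0 m.+1) -(size_map e).
apply: uniq_leq_size; first by rewrite map_inj_uniq ?iota_uniq.
move=> _ /mapP[i +] ->; rewrite mem_iota ltnS /= => im.
rewrite mem_filter mem_iota /= add0n (leq_ltn_trans (ele _ _ im) emc) andbT.
by have : elts x (e i) by rewrite -eran; exists i.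
Qed.

Lemma concentrated_hurewicz_meager_unbounded (X : set cantor_space) :
  X `<=` infsets -> bfrak #<= X -> concentrated bfrak (X `|` Fin) Fin ->
  (forall A : set cantor_space, A `<=` X -> card_lt A bfrak ->
     hurewicz (set_type ((X `\` A) `|` Fin))) ->
  meager_unbounded X.
Proof.
move=> Xinf Xcard [_ _ conc] hur; split=> // b binf.
pose e := enumeration b; pose U n := \bigcup_k sparse e n k.
pose A := \bigcup_n (X `\` U n).
have AX : A `<=` X by move=> x [n _ []].
have Alt : card_lt A bfrak.
  apply: card_lt_bfrak_bigcup => n.
  apply: card_lt_subset (conc (U n) _ (@Fin_sparse e n)).
    by move=> x [Xx Ux]; split=> //; left.
  by apply: bigcup_open => k _; exact: open_sparse.
pose Z := (X `\` A) `|` Fin.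
pose C n : set (set Z) := range (fun k => set_val @^-1` sparse e n k).
have [|F [FC Fcof]] := hur A AX Alt C.
  move=> n; split.
    by move=> _ [k _ <-]; exists (sparse e n k) => //; exact: open_sparse.
  apply/seteqP; split=> // z _.
  have [k _ zk] : U n (set_val z).
    have [[Xz nAz]|] := set_valP z; last exact: Fin_sparse.
    by apply: contrapT => nUz; apply: nAz; exists n.
  by exists (set_val @^-1` sparse e n k) => //; exists k.
have /choice[g0 g0P] n : exists k, \bigcup_(V in F n) V `<=`
    set_val @^-1` sparse e n k.
  have [/finite_seqP[s Fs] FCn] := FC n.
  have /choice[k kP] (V : set Z) : exists k, F n V -> V = set_val @^-1` sparse e n k.
    have [/FCn[k _ <-]|nFV] := pselect (F n V); first by exists k.
    by exists 0%N.
  exists (\max_(V <- s) k V) => z [V FV]; rewrite (kP V FV) => Vz.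
  apply: sparseW Vz; apply: (@leq_bigmax_seq _ s xpredT k V) => //.
  by rewrite Fs in FV.
(* The term [n.+1] keeps the intervals nonempty, as [hits_meager_semifilter] demands. *)
pose g n := maxn (g0 n) n.+1.
exists (hits g), A; split=> //.
  by apply: hits_meager_semifilter => n; rewrite leq_max leqnn orbT.
move=> x [Xx nAx]; have Zx : Z x by left.
have [N NP] := (cofinite_eventually _).1 (Fcof (SigSub (mem_set Zx))).
exists N => n /NP /g0P /= [m /andP[nm mg] xm]; exists m.
  by rewrite nm leq_max mg.
by apply: count_le_enumeration => //; exact: Xinf.
Qed.

(** * From sigma-compact sets to concentration and the Hurewicz property *)

Lemma cantor_space_base : exists B : nat -> set cantor_space,
  (forall i, open (B i)) /\
  forall U x, open U -> U x -> exists2 i, B i x & B i `<=` U.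
Proof.
exists (fun i => if @unpickle (seq bool) i is Some s then
  [set x | agree (size s) (nth false s) x] else set0); split.
  move=> i; case: unpickle => [s|]; last exact: open0.
  apply/open_agreeP => x sx; exists (size s) => y xy.
  exact: agree_trans sx xy.
move=> U x /open_agreeP oU /oU[m mU]; exists (pickle (mkseq x m)).
  by rewrite pickleK /= size_mkseq => i im; rewrite nth_mkseq.
rewrite pickleK => y /=; rewrite size_mkseq => xy; apply: mU => i im.
by rewrite -xy// nth_mkseq.
Qed.

Lemma compact_agree (C : set cantor_space) :
  (forall x, ~ C x -> exists m, forall y, agree m x y -> ~ C y) -> compact C.
Proof.
move=> Ccl; apply: (subclosed_compact _ cantor_space_compact) => //.
by rewrite -openC; apply/open_agreeP.
Qed.

Lemma sigma_compact_Fin : sigma_compact Fin.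
Proof.
exists (fun n => [set x | forall i, (n <= i)%N -> ~ x i]); split.
  move=> n; apply: compact_agree => x /existsNP[i /not_implyP[ni /contrapT xi]].
  by exists i.+1 => y xy /(_ i ni); rewrite -xy.
apply/seteqP; split=> [x /finite_bounded[n xn]|x [n _ xn]].
  by exists n => // i ni /xn; rewrite ltnNge ni.
apply/finite_boundedP; exists n => i xi.
by rewrite ltnNge; apply/negP => /xn.
Qed.

Lemma sigma_compactU {T : topologicalType} (A B : set T) :
  sigma_compact A -> sigma_compact B -> sigma_compact (A `|` B).
Proof.
move=> [K [cK ->]] [L [cL ->]]; exists (fun n => K n `|` L n).
by split=> [n|]; [exact: compactU|rewrite bigcupU].
Qed.

Lemma hurewicz_sigma_compact (Z : set cantor_space) :
  (forall G, Gdelta G -> Z `<=` G -> exists F,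
     [/\ sigma_compact F, F `<=` G & card_lt (Z `\` F) bfrak]) ->
  hurewicz (set_type Z).
Proof.
move=> ZG U Ucov; have [B [oB Bbase]] := cantor_space_base.
have /choice[ext extP] (V : set Z) : exists W : set cantor_space,
    open V -> open W /\ set_val @^-1` W = V.
  have [[W oW WV]|nV] := pselect (open V); first by exists W.
  by exists set0.
pose G := \bigcap_n \bigcup_(V in U n) ext V.
have Gd : Gdelta G.
  exists (fun n => \bigcup_(V in U n) ext V) => // n.
  by apply: bigcup_open => V /((Ucov n).1)/extP[].
have ZsubG : Z `<=` G.
  move=> x Zx n _; pose z : Z := SigSub (mem_set Zx).
  have : setT z by [].
  rewrite -(Ucov n).2 => -[V UV Vz]; exists V => //.
  by have [_ VE] := extP _ ((Ucov n).1 _ UV); rewrite -VE in Vz.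
have [F [[K [cK FE]] FG Zlt]] := ZG G Gd ZsubG.
(* Replacing members of the cover by indices of basic sets inside them makes the choices natural
   numbers, which can be compared with [le_star]. *)
pose D n := [set i | exists2 V, U n V & B i `<=` ext V].
have DP n x : G x -> exists2 i, D n i & B i x.
  move=> /(_ n I)[V UV Vx].
  have [i Bx BV] := Bbase _ _ (extP _ ((Ucov n).1 _ UV)).1 Vx.
  by exists i => //; exists V.
have /choice[v vP] (ni : nat * nat) : exists V, D ni.1 ni.2 ->
    U ni.1 V /\ B ni.2 `<=` ext V.
  have [[V UV BV]|nD] := pselect (D ni.1 ni.2); first by exists V.
  by exists set0.
have /choice[f fP] (x : cantor_space) : exists u : nat -> nat, G x ->
    forall n, D n (u n) /\ B (u n) x.
  have [Gx|nGx] := pselect (G x); last by exists id.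
  have /choice[u uP] n : exists i, D n i /\ B i x.
    by have [i] := DP n x Gx; exists i.
  by exists u.
(* A finite subcover of the compact set [K k] bounds the index needed at each [n]. *)
have /choice[N NP] (k : nat) : exists u : nat -> nat, forall n x, K k x ->
    exists i, [/\ D n i, B i x & (i <= u n)%N].
  suff /choice[u uP] n : exists b, forall x, K k x ->
    exists i, [/\ D n i, B i x & (i <= b)%N] by exists u.
  have := cK k; rewrite compact_cover => /(_ nat (D n) B (fun i _ => oB i)).
  case=> [x Kx|E ED Ecov].
    by have [|i Di Bx] := DP n x; [apply: FG; rewrite FE; exists k|exists i].
  exists (\max_(i <- finmap.enum_fset E) i) => x /Ecov[i /= Ei Bx]; exists i; split=> //.
    exact/set_mem/ED.
  exact: (@leq_bigmax_seq _ (finmap.enum_fset E) xpredT id i Ei).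
have [h hP] := le_star_seq_bound N.
have [g gP] := card_lt_bfrak_bounded f Zlt.
(* [h] serves the points of [F] and [g] the fewer than [bfrak] points of [Z] outside [F]; the
   successor makes the bound strict, as [I_(c n)] requires. *)
pose c n := (maxn (g n) (h n)).+1.
exists (fun n => (fun i => v (n, i)) @` (D n `&` `I_(c n))); split.
  move=> n; split.
    by apply: finite_image; apply: finite_setIr; exact: finite_II.
  by move=> _ [i [Di _] <-]; exact: (vP (n, i) Di).1.
move=> z; apply/cofinite_eventually.
have Zz : Z (set_val z) by exact: set_valP.
suff [m mP] : exists m, forall n, (m <= n)%N ->
    exists i, [/\ D n i, B i (set_val z) & (i < c n)%N].
  exists m => n /mP[i [Di Bz ic]]; exists (v (n, i)); first by exists i.
  have [/((Ucov n).1)/extP[_ VE] /(_ _ Bz)] := vP (n, i) Di.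
  by move=> ez; rewrite -VE.
have [Fz|nFz] := pselect (F (set_val z)).
  move: Fz; rewrite FE => -[k _ Kz].
  have /le_starP[m mh] := hP k; exists m => n /mh nh.
  have [i [Di Bi iN]] := NP k n _ Kz; exists i; split=> //.
  by rewrite ltnS leq_max (leq_trans iN nh) orbT.
have /le_starP[m mg] := gP _ (conj Zz nFz); exists m => n /mg ng.
have [Di Bi] := fP _ (ZsubG _ Zz) n; exists (f (set_val z) n).
by split=> //; rewrite ltnS leq_max ng.
Qed.

Lemma sigma_compact_concentrated_hurewicz (X : set cantor_space) :
  bfrak #<= X ->
  (forall G : set cantor_space, Gdelta G -> Fin `<=` G ->
     exists F : set cantor_space,
       [/\ sigma_compact F, F `<=` G & card_lt (X `\` F) bfrak]) ->
  concentrated bfrak (X `|` Fin) Fin /\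
  (forall A : set cantor_space, A `<=` X -> card_lt A bfrak ->
     hurewicz (set_type ((X `\` A) `|` Fin))).
Proof.
move=> Xcard XG; split.
  split; first exact: subsetUr.
    by apply: card_le_trans Xcard _; apply: subset_card_le; exact: subsetUl.
  move=> U oU FinU; have [F [_ FU]] := XG U (open_Gdelta oU) FinU.
  apply: card_lt_subset => x [Xx nUx]; split=> [|/FU//].
  by case: Xx => // /FinU.
move=> A AX _; apply: hurewicz_sigma_compact => G Gd ZG.
have FinG : Fin `<=` G by move=> x Fx; apply: ZG; right.
have [F [cF FG XF]] := XG G Gd FinG.
(* Adding [Fin] leaves uncovered only points of [X] outside [F]. *)
exists (F `|` Fin); split.
- exact: sigma_compactU cF sigma_compact_Fin.
- by move=> x [/FG|/FinG].
- apply: card_lt_subset XF => x [Zx nFx].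
  by case: Zx => [[Xx _]|Fx]; [split=> // ?|]; case: nFx; [left|right].
Qed.

(** * From meager unboundedness to sigma-compact sets *)

Lemma incr_ge_id (h : nat -> nat) :
  (forall k, (h k < h k.+1)%N) -> forall k, (k <= h k)%N.
Proof. by move=> hS; elim=> // k IH; exact: leq_ltn_trans (hS k). Qed.

Lemma incr_le (h : nat -> nat) :
  (forall k, (h k < h k.+1)%N) -> {homo h : i j / (i <= j)%N}.
Proof. by move=> hS; apply: ltnW_homo; exact: (homo_ltn ltn_trans hS). Qed.

Lemma block_inj (h : nat -> nat) k l i : (forall k, (h k < h k.+1)%N) ->
  (h k <= i < h k.+1)%N -> (h l <= i < h l.+1)%N -> k = l.
Proof.
by move=> /incr_le hle hk hl; case: (ltngtP k l) => // /hle /=; lia.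
Qed.

Definition misses (h : nat -> nat) (k : nat) (x : nat -> bool) : Prop :=
  forall i, (h k <= i < h k.+1)%N -> ~~ x i.

(** The listed pairs are treated one by one, each lengthening the pattern [t], so that one pattern
    finally works after every listed prefix. *)
Lemma nowhere_dense_avoid (N : nat -> set (set_type infsets)) :
  (forall j, nowhere_dense (N j)) -> forall n (L : seq (cantor_space * nat)),
  exists m (t : cantor_space), (n < m)%N /\
    forall p j, (p, j) \in L -> forall a : set_type infsets,
      agree n p (\val a) ->
      (forall i, (n <= i < m)%N -> (\val a) i = t i) -> ~ N j a.
Proof.
move=> Nnd n; elim=> [|[p j] L [m [t [nm mt]]]]; first by exists n.+1, point.
(* The prefix [p], then the pattern built so far; the tail [true] keeps [x] infinite. *)
pose x : cantor_space := fun i =>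
  if (i < n)%N then p i else if (i < m)%N then t i else true.
have xinf : infsets x.
  apply/infsets_frequently => k; exists (maxn k m); first exact: leq_maxl.
  by rewrite /x !ifN// -leqNgt leq_max ?leqnn ?(ltnW nm) orbT.
have [y [m' [xy mm' yN]]] :=
  (nowhere_denseP (N j)).1 (Nnd j) (SigSub (mem_set xinf)) m.
exists m', (\val y); split; first exact: leq_trans mm'.
move=> q l; rewrite in_cons => /orP[/eqP[-> ->] a pa ay|qL a qa ay].
  apply: yN => i im'; have [ilt|nle] := ltnP i n.
    by rewrite -pa// -xy /= ?/x ?ilt// (ltn_trans ilt nm).
  by rewrite ay// nle.
apply: (mt q l qL a qa) => i /andP[ni im].
by rewrite ay ?ni ?(leq_trans im mm')// -xy//= /x ltnNge ni im.
Qed.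

(* The nontrivial half of Talagrand's characterization of meager filters,
   valid for semifilters. *)
Lemma meager_semifilter_hits {S : set cantor_space} : meager_semifilter S ->
  exists h : nat -> nat, (forall k, (h k < h k.+1)%N) /\
    forall a, S a -> exists m, forall k, (m <= k)%N -> ~ misses h k a.
Proof.
move=> [[_ Sinf Sup] [N [Nnd SN]]].
(* Treating all prefixes of length [n] at once yields a pattern that leaves [N 0], ..., [N n]
   whatever comes before it. *)
have /choice[mt mtP] n : exists mt : nat * cantor_space, (n < mt.1)%N /\
    forall j, (j <= n)%N -> forall a : set_type infsets,
      (forall i, (n <= i < mt.1)%N -> (\val a) i = mt.2 i) -> ~ N j a.
  have [P PP] := finite_prefixes n.
  have [m [t [nm mtP]]] :=
    nowhere_dense_avoid N Nnd n [seq (p, j) | p <- P, j <- iota 0 n.+1].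
  exists (m, t); split=> // j jn a at_.
  have [p pP pa] := PP (\val a); apply: (mtP p j) pa at_.
  by apply/allpairsP; exists (p, j); rewrite mem_iota.
pose h k := iter k (fun n => (mt n).1) 0%N.
have hS k : (h k < h k.+1)%N by exact: (mtP (h k)).1.
exists h; split=> // a Sa; apply: contrapT => nom.
have often m : exists2 k, (m <= k)%N & misses h k a.
  apply: contrapT => nok; apply: nom; exists m => k mk ka.
  by apply: nok; exists k.
(* On every block missed by [a], insert the pattern that leaves [N j]. *)
pose P i := exists k, [/\ (h k <= i < h k.+1)%N, misses h k a & (mt (h k)).2 i].
pose a' : cantor_space := fun i => a i || `[< P i >].
have a'inf : infsets a'.
  apply/infsets_frequently => n.
  have [i ni ai] := (infsets_frequently a).1 (Sinf a Sa) n.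
  by exists i => //; rewrite /a' ai.
have Sa' : S a'.
  apply: (Sup a) => //; rewrite (_ : _ `\` _ = set0)//.
  by apply/seteqP; split=> // i [ai]; case; rewrite /elts /= /a' ai.
have [j _ Nja'] := SN (SigSub (mem_set a'inf)) Sa'.
(* Since [j <= k <= h k], the pattern of block [k] avoids [N j]; [a'] equals it there because [a] is
   empty on that block and blocks are disjoint. *)
have [k jk ka] := often j.
apply: (mtP (h k)).2 Nja'; first exact: leq_trans jk (incr_ge_id h hS k).
move=> i hi /=; rewrite /a' (negbTE (ka i hi)) /=.
apply/asboolP/idP => [[l [hl _]]|ti]; last by exists k.
by rewrite (block_inj h k l i).
Qed.

(** Each of the finitely many prefixes of length [n], continued by zeros, is a finite set and has a
    cylinder inside [U]; [m] bounds their lengths. *)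
Lemma open_Fin_misses (U : set cantor_space) : open U -> Fin `<=` U ->
  forall n, exists2 m, (n < m)%N &
    forall x : cantor_space, (forall i, (n <= i < m)%N -> ~~ x i) -> U x.
Proof.
move=> /open_agreeP oU FinU n; have [L LP] := finite_prefixes n.
pose q (p : cantor_space) : cantor_space := fun i => (i < n)%N && p i.
have /choice[f fP] (p : cantor_space) :
    exists m, forall y, agree m (q p) y -> U y.
  apply/oU/FinU/finite_boundedP; exists n => i.
  by rewrite /elts /= /q => /andP[].
exists (maxn n.+1 (\max_(p <- L) f p)); first by rewrite leq_max leqnn.
move=> x xn; have [p pL px] := LP x; apply: (fP p) => i ifp.
rewrite /q; have [ilt|nle] := ltnP i n; first by rewrite px.
apply/esym/negbTE/xn; rewrite nle leq_max; apply/orP; right.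
apply: leq_trans ifp _.
exact: (@leq_bigmax_seq _ L xpredT f p pL).
Qed.

Lemma Gdelta_Fin_misses (G : set cantor_space) : Gdelta G -> Fin `<=` G ->
  exists b : nat -> nat, (forall k, (b k < b k.+1)%N) /\
    forall x : cantor_space,
      (forall n, exists2 k, (n <= k)%N & misses b k x) -> G x.
Proof.
move=> [A oA ->] FinA.
have /choice[f fP] (jn : nat * nat) : exists m, (jn.2 < m)%N /\
    forall x : cantor_space,
      (forall i, (jn.2 <= i < m)%N -> ~~ x i) -> A jn.1 x.
  have [|m ? ?] := open_Fin_misses _ (oA jn.1) _ jn.2; last by exists m.
  by move=> x /FinA; apply.
(* The maximum over [j <= n] replaces a decreasing sequence: missing a block of index [k >= j] puts
   [x] into [A j], as [j <= b k]. *)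
pose next n := \max_(j < n.+1) f (j : nat, n).
pose b k := iter k next 0%N.
have fnext j n : (j <= n)%N -> (f (j, n) <= next n)%N.
  by move=> jn; exact: (leq_bigmax (Ordinal (jn : j < n.+1)%N)).
have bS k : (b k < b k.+1)%N.
  exact: leq_trans (fP (0%N, b k)).1 (fnext _ _ (leq0n _)).
exists b; split=> // x xb j _; have [k jk xk] := xb j.
apply: (fP (j, b k)).2 => i /andP[/= bi ilt]; apply: xk; rewrite bi /=.
by apply: leq_trans ilt (fnext _ _ _); exact: leq_trans jk (incr_ge_id b bS k).
Qed.

(** The enumeration of [a] is [e] composed with a strictly increasing [idx], and [n <= idx n]. *)
Lemma enumeration_range_ge (e : nat -> nat) (a : cantor_space) :
  {homo e : m n / (m < n)%N} -> elts a = range e -> infsets a /\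
  forall n, (e n <= enumeration a n)%N.
Proof.
move=> einc aran; have eS k : (e k < e k.+1)%N by exact: einc.
have ainf : infsets a.
  apply/infsets_frequently => m; exists (e m); first exact: incr_ge_id.
  by have : range e (e m) by []; rewrite -aran.
split=> // n; have [ainc ar] := enumerationP ainf.
have /choice[idx idxE] i : exists k, enumeration a i = e k.
  have : range e (enumeration a i) by rewrite -aran -ar.
  by case=> k _ <-; exists k.
rewrite idxE; apply: (incr_le e eS); apply: incr_ge_id => k.
rewrite ltnNge; apply/negP => /(incr_le e eS); rewrite -!idxE.
by rewrite leqNgt ainc.
Qed.

(** Pigeonhole: if [x] met all [n.+1] blocks with index from [n] to [2n], it would have [n.+1]
    elements below [b n.*2.+1], but only [e 0], ..., [e n.-1] can lie there. *)
Lemma misses_of_enumeration (b : nat -> nat) (x : cantor_space) n :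
  (forall k, (b k < b k.+1)%N) -> infsets x ->
  (b n.*2.+1 <= enumeration x n)%N ->
  exists2 i, (n <= i < n.*2.+1)%N & misses b i x.
Proof.
move=> bS /enumerationP; set e := enumeration x => -[einc eran] be.
apply: contrapT => nomiss; have ble := incr_le b bS.
have /choice[y yP] i : exists j, (n <= i < n.*2.+1)%N ->
    (b i <= j < b i.+1)%N && x j.
  have [ni|nni] := boolP (n <= i < n.*2.+1)%N; last by exists 0%N.
  apply: contrapT => noj; apply: nomiss; exists i => // j bj.
  by apply/negP => xj; apply: noj; exists j => _; rewrite bj.
suff : (size [seq y i | i <- iota n n.+1] <= size [seq e i | i <- iota 0 n])%N.
  by rewrite !size_map !size_iota ltnn.
apply: uniq_leq_size.
  rewrite map_inj_in_uniq ?iota_uniq// => i j.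
  rewrite !mem_iota => ni nj yij; have := yP i; have := yP j.
  case: (ltngtP i j) => // /ble; lia.
move=> _ /mapP[i + ->]; rewrite mem_iota => ni.
have /andP[byi xyi] : (b i <= y i < b i.+1)%N && x (y i) by apply: yP; lia.
have : range e (y i) by rewrite eran.
case=> k _ eky; rewrite -eky; apply/mapP; exists k => //; rewrite mem_iota /=.
rewrite add0n ltnNge; apply/negP => nk.
have := ltnW_homo einc nk; have : (b i.+1 <= b n.*2.+1)%N by apply: ble; lia.
by rewrite /= -/e; lia.
Qed.

Lemma meager_unbounded_sigma_compact (X : set cantor_space) :
  meager_unbounded X ->
  forall G : set cantor_space, Gdelta G -> Fin `<=` G ->
    exists F : set cantor_space,
      [/\ sigma_compact F, F `<=` G & card_lt (X `\` F) bfrak].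
Proof.
move=> [Xinf _ Xmu] G Gd FinG.
have [b [bS bG]] := Gdelta_Fin_misses G Gd FinG.
have ble := incr_le b bS.
pose e n := b n.*2.+1.
have einc : {homo e : m n / (m < n)%N}.
  by move=> m n mn; apply: (homo_ltn ltn_trans bS); lia.
pose b' : cantor_space := fun i => `[< range e i >].
have [|b'inf b'e] := enumeration_range_ge e b' einc.
  by apply/seteqP; split=> i; rewrite /elts /b' /= => /asboolP.
have [S [A [mS AX Alt XA]]] := Xmu b' b'inf.
have [h [hS Sh]] := meager_semifilter_hits mS.
have hle := incr_le h hS.
(* A good [n] below [h k.+1] yields a missed block of index at most [2n], hence the bound
   [(h k.+1).*2]. *)
pose C m : set cantor_space := [set x | forall k, (m <= k)%N ->
  exists2 i, (h k <= i < (h k.+1).*2)%N & misses b i x].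
exists (\bigcup_m C m); split.
- exists C; split=> // m; apply: compact_agree => x.
  (* The condition at [k] depends only on [x] below [b (h k.+1).*2], so its failure is open. *)
  move=> /existsNP[k /not_implyP[mk nx]]; exists (b (h k.+1).*2) => y xy Cy.
  apply: nx; have [i hi yi] := Cy k mk; exists i => // j bj.
  rewrite xy; first exact: yi.
  have : (b i.+1 <= b (h k.+1).*2)%N by apply: ble; lia.
  by lia.
- move=> x [m _ xm]; apply: bG => n.
  have [i hi xi] := xm _ (leq_maxl m n); exists i => //.
  by have := incr_ge_id h hS (maxn m n); lia.
- apply: card_lt_subset Alt => x [Xx nCx]; apply: contrapT => nAx; apply: nCx.
  have [m mP] := Sh _ (XA x (conj Xx nAx)); exists m => // k mk.
  have /existsNP[n /not_implyP[hn /negP/negPn bx]] := mP k mk.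
  have [i ni xi] : exists2 i, (n <= i < n.*2.+1)%N & misses b i x.
    apply: misses_of_enumeration => //; first exact: Xinf.
    exact: leq_trans (b'e n) bx.
  by exists i => //; lia.
Qed.

Theorem theorem2p2 (X : set cantor_space)
    (Xinf : X `<=` infsets) (Xcard : bfrak #<= X) :
  [<-> meager_unbounded X ;
       forall G : set cantor_space, Gdelta G -> Fin `<=` G ->
         exists F : set cantor_space,
           [/\ sigma_compact F, F `<=` G & card_lt (X `\` F) bfrak] ;
       concentrated bfrak (X `|` Fin) Fin /\
       (forall A : set cantor_space, A `<=` X -> card_lt A bfrak ->
         hurewicz (set_type ((X `\` A) `|` Fin)))].
Proof.
tfae.
- exact: meager_unbounded_sigma_compact.
- exact: sigma_compact_concentrated_hurewicz.
- by move=> [conc hur]; exact: concentrated_hurewicz_meager_unbounded.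
Qed.
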